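(* Let $E$ be a CM field of degree $2g$ over $\mathbb{Q}$ and let $\Sigma$ be a CM type on $E$, with reflex field $E'$. If $g\le3$, then the reciprocity morphism $r:R_{E'}\to R_E$ has connected kernel.
   Context: $E^c\subset\overline{\mathbb{Q}}\subset\mathbb{C}$ is the Galois closure of $E$ over $\mathbb{Q}$, $\rho$ is complex conjugation. Put $\mathfrak{g}=\mathrm{Gal}(E^c/\mathbb{Q})$, acting on the right on $E^c$ (so $\alpha\beta$ means $\alpha$ followed by $\beta$), and $\mathfrak{h}=\mathrm{Gal}(E^c/E)$. Then $J=\mathrm{Hom}(E,\overline{\mathbb{Q}})=\mathfrak{h}\backslash\mathfrak{g}$ with right $\mathfrak{g}$-action. A CM type is a subset $\Sigma\subset J$ with $J=\Sigma\sqcup\Sigma\rho$; write $\Sigma=\{\mathfrak{h}\alpha_1,\dots,\mathfrak{h}\alpha_g\}$. For a number field $M$, $R_M=\mathrm{Res}_{M/\mathbb{Q}}\mathbb{G}_{m,M}$; $X_*$ denotes the cocharacter lattice, and $X_*(R_E)=\bigoplus_{\mathfrak{h}\alpha\in\mathfrak{h}\backslash\mathfrak{g}}\mathbb{Z}\,\mathfrak{h}\alpha$. Let $\tilde\Sigma=\{\alpha\in\mathfrak{g}:\mathfrak{h}\alpha\in\Sigma\}$, $\mathfrak{h}'=\{\alpha\in\mathfrak{g}:\tilde\Sigma\alpha=\tilde\Sigma\}$; the reflex field $E'\subset E^c$ of $(E,\Sigma)$ is the fixed field of $\mathfrak{h}'$. The reciprocity morphism $r:R_{E'}\to R_E$ is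 the morphism of $\mathbb{Q}$-tori given on cocharacters by $$X_*(r):X_*(R_{E'})=\bigoplus_{\mathfrak{h}'\beta\in\mathfrak{h}'\backslash\mathfrak{g}}\mathbb{Z}\,\mathfrak{h}'\beta\to X_*(R_E),\qquad \mathfrak{h}'\beta\mapsto\sum_{i=1}^g\mathfrak{h}\alpha_i\beta .$$ *)

(* Defs.v *)
From mathcomp Require Import all_boot all_order all_algebra all_fingroup all_field.
From mathcomp Require Import mpoly.

Set Implicit Arguments.
Unset Strict Implicit.
Unset Printing Implicit Defensive.

Import GroupScope GRing.Theory Num.Theory.
Local Open Scope ring_scope.

(* Split tori over [algC], presented by a finite basis [I] of the cocharacter  *)
(* lattice X = Z^I: the points are X (x) algC^* = (algC^* )^I.                  *)

Definition cochar (I : finType) := {ffun I -> int}.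

Definition cochar_basis (I : finType) (i : I) : cochar I :=
  [ffun k => (k == i)%:R].

Definition torus (I : finType) (t : {ffun I -> algC}) : Prop :=
  forall i, t i != 0.

(* The map X (x) algC^* -> Y (x) algC^* induced by phi : X -> Y.               *)
Definition torus_map (I J : finType) (phi : cochar I -> cochar J)
    (t : {ffun I -> algC}) : {ffun J -> algC} :=
  [ffun j => \prod_i t i ^ (phi (cochar_basis i) j)].

Definition torus_ker (I J : finType) (phi : cochar I -> cochar J)
    (t : {ffun I -> algC}) : Prop :=
  torus t /\ forall j, torus_map phi t j = 1.

(* Closed subsets of affine space algC^I. The Zariski topology of the torus is *)
(* the one induced from it, since Laurent polynomials and polynomials have the *)
(* same zero loci in the torus.                                                *)
Definition zariski_closed (I : finType) (Z : {ffun I -> algC} -> Prop) : Prop :=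
  exists S : {mpoly algC[#|I|]} -> Prop,
    forall t, Z t <-> (forall p, S p -> p.@[fun k => t (enum_val k)] = 0).

Definition zariski_connected (I : finType) (X : {ffun I -> algC} -> Prop) : Prop :=
  (exists t, X t) /\
  forall Z1 Z2 : {ffun I -> algC} -> Prop,
    zariski_closed Z1 -> zariski_closed Z2 ->
    (forall t, X t -> Z1 t \/ Z2 t) ->
    (exists t, X t /\ Z1 t) -> (exists t, X t /\ Z2 t) ->
    exists t, [/\ X t, Z1 t & Z2 t].

Definition totally_real (F : fieldExtType rat) : Prop :=
  forall (f : {rmorphism F -> algC}) (x : F), f x \in Num.real.

Definition totally_imaginary (F : fieldExtType rat) : Prop :=
  forall f : {rmorphism F -> algC}, exists x : F, f x \notin Num.real.

Definition CM_field (L : fieldExtType rat) (E : {subfield L}) : Prop :=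
  totally_imaginary (subvs_of E) /\
  exists F : {subfield L},
    [/\ (F <= E)%VS, \dim_F E = 2%N & totally_real (subvs_of F)].

Section Galois.

Variable L : splittingFieldType rat.

Definition galois_closure (E : {subfield L}) : Prop :=
  galois 1%AS {:L} /\
  forall K : {subfield L}, (E <= K)%VS -> galois 1%AS K -> ({:L} <= K)%VS.

Definition complex_conj (iota : {rmorphism L -> algC}) (rho : gal_of {:L}) : Prop :=
  forall x : L, iota (rho x) = (iota x)^*.

Definition galQ : {group gal_of {:L}} := 'Gal({:L} / 1%AS)%G.

(* Hom(M, Qbar) as h\g with h = Gal(L / M): the product x * y in [gal_of] is    *)
(* x followed by y, so these are the sets h :* alpha, and g acts on the right. *)
Definition emb (M : {subfield L}) :=
  {C : {set gal_of {:L}} | C \in rcosets 'Gal({:L} / M) galQ}.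

Lemma mem_galQ (a : gal_of {:L}) : a \in galQ.
Proof.
rewrite gal_kHom ?sub1v //; apply/kAHomP => x.
by case/vlineP=> k ->; rewrite linearZ /= rmorph1.
Qed.

Lemma emb_of_subproof (M : {subfield L}) (a : gal_of {:L}) :
  'Gal({:L} / M) :* a \in rcosets 'Gal({:L} / M) galQ.
Proof. by apply/rcosetsP; exists a; rewrite ?mem_galQ. Qed.

Definition emb_of (M : {subfield L}) (a : gal_of {:L}) : emb M :=
  Sub ('Gal({:L} / M) :* a) (emb_of_subproof M a).

Lemma emb_act_subproof (M : {subfield L}) (C : emb M) (a : gal_of {:L}) :
  val C :* a \in rcosets 'Gal({:L} / M) galQ.
Proof.
case/rcosetsP: (valP C) => b _ ->.
by rewrite -rcosetM; apply/rcosetsP; exists (b * a)%g; rewrite ?mem_galQ.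
Qed.

Definition emb_act (M : {subfield L}) (C : emb M) (a : gal_of {:L}) : emb M :=
  Sub (val C :* a) (emb_act_subproof C a).

Definition CM_type (rho : gal_of {:L}) (E : {subfield L}) (Sigma : {set emb E}) : Prop :=
  let Sigma_rho := [set emb_act C rho | C in Sigma] in
  Sigma :|: Sigma_rho = [set: emb E] /\ Sigma :&: Sigma_rho = set0.

Section Reflex.

Variables (E : {subfield L}) (Sigma : {set emb E}).

Definition lift_type : {set gal_of {:L}} :=
  [set a in galQ | emb_of E a \in Sigma].

Definition reflex_group : {set gal_of {:L}} :=
  [set a in galQ | lift_type :* a == lift_type].

Definition reflex_field : {subfield L} := [aspace of fixedField reflex_group].

(* X_*(r) on the cocharacters of R_{E'} = Res_{E'/Q} G_m; [reciprocityE] shows *)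
(* that the choice of representative is immaterial.                            *)
Definition reciprocity (x : cochar (emb reflex_field)) : cochar (emb E) :=
  \sum_(B : emb reflex_field)
    (\sum_(C in Sigma) cochar_basis (emb_act C (repr (val B)))) *~ x B.

End Reflex.

Lemma emb_of_act (M : {subfield L}) a b :
  emb_act (emb_of M a) b = emb_of M (a * b)%g.
Proof. by apply: val_inj; rewrite /= rcosetM. Qed.

Lemma emb_actM (M : {subfield L}) (C : emb M) a b :
  emb_act C (a * b)%g = emb_act (emb_act C a) b.
Proof. by apply: val_inj; rewrite /= rcosetM. Qed.

Lemma emb_act_inj (M : {subfield L}) a :
  injective (fun C : emb M => emb_act C a).
Proof. by move=> C D /(congr1 val) /= /rcoset_inj /val_inj. Qed.

Lemma reflex_group_set (E : {subfield L}) (Sigma : {set emb E}) :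
  group_set (reflex_group Sigma).
Proof.
apply/group_setP; split; first by rewrite inE mem_galQ rcoset1 eqxx.
move=> a b; rewrite !inE !mem_galQ /= => /eqP ha /eqP hb.
by rewrite rcosetM ha hb.
Qed.

Lemma gal_reflex_field (E : {subfield L}) (Sigma : {set emb E}) :
  'Gal({:L} / reflex_field Sigma) = reflex_group Sigma.
Proof. exact: (gal_fixedField (Group (reflex_group_set Sigma))). Qed.

Lemma reflex_group_act (E : {subfield L}) (Sigma : {set emb E}) a :
  a \in reflex_group Sigma -> [set emb_act C a | C in Sigma] = Sigma.
Proof.
rewrite inE mem_galQ /= => /eqP ha.
apply/eqP; rewrite eqEcard card_imset ?leqnn ?andbT; last exact: emb_act_inj.
apply/subsetP=> _ /imsetP[C CS ->].
have [b _ defC] := rcosetsP (valP C).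
have defCb : C = emb_of E b by apply: val_inj.
rewrite defCb emb_of_act.
have : (b * a)%g \in lift_type Sigma.
  rewrite -ha; apply/rcosetP; exists b => //.
  by rewrite inE mem_galQ /= -defCb.
by rewrite inE mem_galQ.
Qed.

Lemma reciprocityE (E : {subfield L}) (Sigma : {set emb E}) (b : gal_of {:L}) :
  reciprocity (cochar_basis (emb_of (reflex_field Sigma) b)) =
  \sum_(C in Sigma) cochar_basis (emb_act C b).
Proof.
rewrite /reciprocity (bigD1 (emb_of (reflex_field Sigma) b)) //=.
rewrite [X in _ + X]big1 ?addr0 => [|B /negPf nB]; last by rewrite ffunE nB mulr0z.
rewrite ffunE eqxx mulr1z.
have: repr ('Gal({:L} / reflex_field Sigma) :* b) \in
        'Gal({:L} / reflex_field Sigma) :* b.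
  exact: (mem_repr _ (rcoset_refl _ b)).
case/rcosetP=> a; rewrite gal_reflex_field => aH ->.
rewrite -[in RHS](reflex_group_act aH).
rewrite big_imset /=; last by move=> C D _ _; apply: emb_act_inj.
by apply: eq_bigr => C _; rewrite emb_actM.
Qed.

End Galois.

(* Main.v *)
Require Import Defs.
From mathcomp Require Import all_boot all_order all_algebra all_fingroup all_field.
From mathcomp Require Import mpoly zify.
From Stdlib Require Classical_Prop.

(** The kernel of a homomorphism of tori is connected as soon as the image of
    the map on cocharacters is a direct summand ([torus_ker_connected]): the
    source torus then retracts onto the kernel by a monomial map, and any two
    points of the kernel lie on the image of a punctured line, which is
    irreducible.

    For the reciprocity morphism, the image on cocharacters is the lattice
    spanned by the indicator functions of the translates [Sigma beta] in the
    set [J] of embeddings of [E]. Complex conjugation commutes with the action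
    of the Galois group on [J] ([emb_conj_central], where the CM hypothesis
    enters), so that every [Sigma beta] is again a CM type, and the complement
    of [Sigma beta] is [Sigma beta rho]: the family is closed under complement.
    Any family of CM types closed under complement spans a direct summand of
    Z^J if [#|J| <= 6] ([types_summand]). Indeed, fix a member [v]; a CM type is
    determined by its trace on [v], a subset of a set with at most three
    elements. Either every member is one of [v], [w] and their complements, or
    there are [v], [w], [u] which, up to complements, are {0,1,2}, {1,2} and
    {0,2} on [v] = {0,1,2}; in each case the members chosen, together with the
    complement of [v], are a basis of the span, and the dual basis is given by
    integral combinations of coordinates. For [g = 4] the lattice spanned by
    such a family can have index 2 in a summand. *)

Set Implicit Arguments.
Unset Strict Implicit.
Unset Printing Implicit Defensive.

Import GroupScope GRing.Theory Num.Theory.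
Local Open Scope ring_scope.

(** * Rational functions of one variable *)

(** The functions [f] regular wherever [U] does not vanish. The numerator and
    denominator are only existentially given, so that closure under the ring
    operations and under inverses of nonvanishing polynomials is immediate. *)
Definition regular_off (U : {poly algC}) (f : algC -> algC) : Prop :=
  exists N D : {poly algC},
    forall s, U.[s] != 0 -> D.[s] != 0 /\ f s = N.[s] / D.[s].

Lemma regular_off_poly U (p : {poly algC}) : regular_off U (horner p).
Proof. by exists p, 1 => s _; rewrite hornerE oner_neq0 divr1. Qed.

Lemma regular_offV U (p : {poly algC}) :
  (forall s, U.[s] != 0 -> p.[s] != 0) -> regular_off U (fun s => p.[s]^-1).
Proof. by move=> hp; exists 1, p => s /hp ps; rewrite hornerE div1r. Qed.

Lemma regular_offD U f h :
  regular_off U f -> regular_off U h -> regular_off U (fun s => f s + h s).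
Proof.
move=> [N [D hf]] [N' [D' hh]]; exists (N * D' + N' * D), (D * D') => s Us.
have [Ds ->] := hf s Us; have [Ds' ->] := hh s Us.
by rewrite !hornerE mulf_neq0 // addf_div.
Qed.

Lemma regular_offM U f h :
  regular_off U f -> regular_off U h -> regular_off U (fun s => f s * h s).
Proof.
move=> [N [D hf]] [N' [D' hh]]; exists (N * N'), (D * D') => s Us.
have [Ds ->] := hf s Us; have [Ds' ->] := hh s Us.
by rewrite !hornerM mulf_neq0 // mulf_div.
Qed.

Lemma eq_regular_off U f h : f =1 h -> regular_off U f -> regular_off U h.
Proof. by move=> eqfh [N [D hf]]; exists N, D => s /hf; rewrite eqfh. Qed.

Lemma regular_off_cst U c : regular_off U (fun=> c).
Proof.
by apply: eq_regular_off (regular_off_poly U c%:P) => s; rewrite hornerC.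
Qed.

Lemma regular_off_sum U (T : Type) (r : seq T) (F : T -> algC -> algC) :
  (forall x, regular_off U (F x)) ->
  regular_off U (fun s => \sum_(x <- r) F x s).
Proof.
move=> hF; elim: r => [|x r IH].
  by apply: eq_regular_off (regular_off_cst U 0) => s; rewrite big_nil.
by apply: eq_regular_off (regular_offD (hF x) IH) => s; rewrite big_cons.
Qed.

Lemma regular_off_prod U (T : Type) (r : seq T) (F : T -> algC -> algC) :
  (forall x, regular_off U (F x)) ->
  regular_off U (fun s => \prod_(x <- r) F x s).
Proof.
move=> hF; elim: r => [|x r IH].
  by apply: eq_regular_off (regular_off_cst U 1) => s; rewrite big_nil.
by apply: eq_regular_off (regular_offM (hF x) IH) => s; rewrite big_cons.
Qed.

Lemma regular_offX U f n :
  regular_off U f -> regular_off U (fun s => f s ^+ n).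
Proof.
move=> hf.
apply: eq_regular_off (regular_off_prod (index_enum 'I_n) (fun=> hf)) => s.
by rewrite prodr_const card_ord.
Qed.

Lemma regular_offXz U (p : {poly algC}) (n : int) :
  (forall s, U.[s] != 0 -> p.[s] != 0) -> regular_off U (fun s => p.[s] ^ n).
Proof.
move=> hp; case: n => n; first exact: regular_offX (regular_off_poly U p).
apply: eq_regular_off (regular_offX n.+1 (regular_offV hp)) => s.
by rewrite NegzE -exprnN exprVn.
Qed.

Lemma regular_off_meval U n (p : {mpoly algC[n]}) (v : algC -> 'I_n -> algC) :
  (forall k, regular_off U (v^~ k)) -> regular_off U (fun s => p.@[v s]).
Proof.
move=> hv; apply: (@eq_regular_off U
  (fun s => \sum_(m <- msupp p) p@_m * \prod_i v s i ^+ m i)) => [s|].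
  by rewrite mevalE.
apply: regular_off_sum => m; apply: regular_offM; first exact: regular_off_cst.
by apply: regular_off_prod => i; apply: regular_offX.
Qed.

(** The affine line is infinite. *)
Lemma horner_eq0 (R : numDomainType) (p : {poly R}) :
  (forall s, p.[s] = 0) -> p = 0.
Proof.
move=> p0; apply/eqP; apply: contraT => pn0.
have := @max_poly_roots R p [seq i%:R | i <- iota 0 (size p)] pn0.
rewrite size_map size_iota ltnn => -> //.
  by apply/allP=> x _; apply/rootP.
by rewrite map_inj_uniq ?iota_uniq // => i j /eqP; rewrite eqr_nat => /eqP.
Qed.

(** Irreducibility of the cofinite subset [U != 0] of the line. *)
Lemma regular_off_mul_eq0 U f h :
  U != 0 -> regular_off U f -> regular_off U h ->
  (forall s, U.[s] != 0 -> f s * h s = 0) ->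
  (forall s, U.[s] != 0 -> f s = 0) \/ (forall s, U.[s] != 0 -> h s = 0).
Proof.
move=> Un0 [N [D hf]] [N' [D' hh]] fh0.
have: U * (N * N') = 0.
  apply: horner_eq0 => s; rewrite !hornerM.
  have [->|Us] := eqVneq U.[s] 0; first by rewrite mul0r.
  have [Ds fE] := hf s Us; have [Ds' hE] := hh s Us.
  apply/eqP; have /eqP := fh0 s Us; rewrite fE hE mulf_div mulf_eq0 invr_eq0.
  by rewrite (negPf (mulf_neq0 Ds Ds')) orbF => /eqP ->; rewrite mulr0.
move/eqP; rewrite !mulf_eq0 (negPf Un0) /= => /orP[]/eqP z; [left|right] => s Us.
  by have [_ ->] := hf s Us; rewrite z horner0 mul0r.
by have [_ ->] := hh s Us; rewrite z horner0 mul0r.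
Qed.

(** * Connected kernels of homomorphisms of tori *)

Lemma expfz_sum (F : fieldType) (T : Type) (r : seq T) (x : F) (n : T -> int) :
  x != 0 -> x ^ (\sum_(k <- r) n k) = \prod_(k <- r) x ^ n k.
Proof.
move=> x0; elim: r => [|k r IH]; first by rewrite !big_nil expr0z.
by rewrite !big_cons expfzDr // IH.
Qed.

Lemma expfz_prod (F : fieldType) (T : Type) (r : seq T) (x : T -> F) (n : int) :
  (\prod_(k <- r) x k) ^ n = \prod_(k <- r) x k ^ n.
Proof.
elim: r => [|k r IH]; first by rewrite !big_nil exp1rz.
by rewrite !big_cons expfzMl IH.
Qed.

Section TorusKernel.

Variables (I J : finType) (phi : cochar I -> cochar J).
Variable b : J -> I -> int.

Let a i j := phi (cochar_basis i) j.
Let q i l := \sum_m a i m * b m l.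

Hypothesis phi_reg : forall i j, a i j = \sum_l q i l * a l j.

Let ker_proj (t : {ffun I -> algC}) : {ffun I -> algC} :=
  [ffun l => t l / \prod_i t i ^ q i l].

Let prodq_neq0 t l : torus t -> \prod_i t i ^ q i l != 0.
Proof. by move=> tT; apply/prodf_neq0 => i _; apply: expfz_neq0. Qed.

Let ker_projP t : torus t -> torus_ker phi (ker_proj t).
Proof.
move=> tT; split=> [l|j].
  by rewrite ffunE mulf_neq0 ?invr_eq0 ?prodq_neq0 ?tT.
rewrite ffunE -/(a _ _).
under eq_bigr => l _ do rewrite ffunE expfzMl.
rewrite big_split /=; under [X in _ * X]eq_bigr => l _ do
  rewrite -expfV -/(a _ _) expfz_prod.
rewrite prodfV exchange_big /=.
under [X in _ / X]eq_bigr => i _.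
  under eq_bigr => l _ do rewrite exprz_exp.
  rewrite -expfz_sum ?tT // -phi_reg.
  over.
rewrite divff //; apply/prodf_neq0 => i _; apply: expfz_neq0; exact: tT.
Qed.

Let ker_proj_id t : torus_ker phi t -> ker_proj t = t.
Proof.
move=> [tT tK]; apply/ffunP => l; rewrite ffunE.
suff -> : \prod_i t i ^ q i l = 1 by rewrite divr1.
under eq_bigr => i _.
  rewrite /q expfz_sum ?tT //; under eq_bigr => m _ do rewrite -exprz_exp.
  over.
rewrite exchange_big big1 // => m _ /=.
by rewrite -expfz_prod; move: (tK m); rewrite ffunE => ->; rewrite exp1rz.
Qed.

(** The hypothesis says that the integer matrix [a] of [phi] satisfies
    [a = a * b * a] for some integer matrix [b], i.e. that the image of [phi] is
    a direct summand. Then the torus retracts onto the kernel, by the monomial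
    map [ker_proj]. Two points of the kernel lie on the image under this
    retraction of the (punctured) affine line joining them, and such an image
    is irreducible. *)
Lemma torus_ker_connected : zariski_connected (torus_ker phi).
Proof.
split.
  exists [ffun=> 1]; split=> [i|j]; first by rewrite ffunE oner_neq0.
  by rewrite ffunE big1 // => i _; rewrite ffunE exp1rz.
move=> Z1 Z2 [S1 S1P] [S2 S2P] cov [x [xK xZ1]] [y [yK yZ2]].
pose u i : {poly algC} := (x i)%:P + (y i - x i) *: 'X.
pose U := \prod_i u i.
pose pt s : {ffun I -> algC} := [ffun i => (u i).[s]].
have Uu i s : U.[s] != 0 -> (u i).[s] != 0.
  by rewrite horner_prod => /prodf_neq0 /(_ i); apply.
have ptT s : U.[s] != 0 -> torus (pt s) by move=> Us i; rewrite ffunE Uu.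
have pt0 : pt 0 = x by apply/ffunP => i; rewrite ffunE !hornerE.
have pt1 : pt 1 = y.
  by apply/ffunP => i; rewrite ffunE hornerD hornerZ hornerC hornerX mulr1 subrKC.
have U0 : U.[0] != 0.
  rewrite horner_prod; apply/prodf_neq0 => i _.
  by rewrite !hornerE; case: xK => /(_ i).
have U1 : U.[1] != 0.
  rewrite horner_prod; apply/prodf_neq0 => i _.
  by rewrite hornerD hornerZ hornerC hornerX mulr1 subrKC; case: yK => /(_ i).
have Un0 : U != 0 by apply: contraNneq U0 => ->; rewrite horner0.
have reg (p : {mpoly algC[#|I|]}) :
    regular_off U (fun s => p.@[fun k => ker_proj (pt s) (enum_val k)]).
  apply: regular_off_meval => k.
  set l := enum_val k.
  apply: (@eq_regular_off U
    (fun s => (u l).[s] * \prod_i (u i).[s] ^ (- q i l))) => [s|].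
    rewrite !ffunE -prodfV; congr (_ * _); apply: eq_bigr => i _.
    by rewrite ffunE invr_expz.
  apply: regular_offM; first exact: regular_off_poly.
  by apply: regular_off_prod => i; apply: regular_offXz => s; apply: Uu.
have curveK s : U.[s] != 0 -> torus_ker phi (ker_proj (pt s)).
  by move=> /ptT; apply: ker_projP.
have c0 : ker_proj (pt 0) = x by rewrite pt0 ker_proj_id.
have c1 : ker_proj (pt 1) = y by rewrite pt1 ker_proj_id.
(* If [Z1] and [Z2] do not meet on the kernel, take an equation of [Z2] not
   vanishing at [x] and one of [Z1] not vanishing at [y]: their product vanishes
   along the curve joining [x] to [y], so one of them does. *)
apply: Classical_Prop.NNPP => disj.
have /S2P nx : ~ Z2 x by move=> xZ2; apply: disj; exists x.
have /S1P ny : ~ Z1 y by move=> yZ1; apply: disj; exists y.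
apply: nx => p2 Sp2; apply: Classical_Prop.NNPP => p2x.
apply: ny => p1 Sp1; apply: Classical_Prop.NNPP => p1y.
case: (regular_off_mul_eq0 Un0 (reg p1) (reg p2)) => [s Us||].
- case: (cov _ (curveK s Us)) => [/S1P /(_ _ Sp1) ->|/S2P /(_ _ Sp2) ->].
    by rewrite mul0r.
  by rewrite mulr0.
- by move/(_ 1 U1); rewrite c1.
- by move/(_ 0 U0); rewrite c0.
Qed.

End TorusKernel.

(** The same criterion for a direct summand with a basis among the vectors
    [phi e_w]; the pairs in [s] consist of an index [w] and of the extension to
    the whole lattice of the corresponding dual basis element. *)
Lemma torus_ker_connected_basis (I J : finType) (phi : cochar I -> cochar J)
    (s : seq (I * (J -> int))) :
  (forall i j, phi (cochar_basis i) j =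
     \sum_(p <- s) (\sum_m phi (cochar_basis i) m * p.2 m) *
                   phi (cochar_basis p.1) j) ->
  zariski_connected (torus_ker phi).
Proof.
move=> hs.
apply: (@torus_ker_connected _ _ _
  (fun m l => \sum_(p <- s) p.2 m * (l == p.1)%:R)) => i j.
rewrite hs.
under [RHS]eq_bigr => l _.
  under eq_bigr => m _ do rewrite mulr_sumr.
  rewrite exchange_big mulr_suml /=.
  under eq_bigr => p _ do
    (under eq_bigr => m _ do rewrite mulrA; rewrite -mulr_suml).
  over.
rewrite exchange_big; apply: eq_bigr => p _ /=.
rewrite (bigD1 p.1) //= eqxx mulr1 [X in _ + X]big1 ?addr0 // => l /negPf ->.
by rewrite mulr0 mul0r.
Qed.

(** * Lattices spanned by CM types *)

Section CMTypes.

Variables (J : finType) (c : J -> J).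

(** CM types, for an abstract conjugation [c] in place of [rho]. *)
Definition is_type (A : {set J}) := forall j, (c j \in A) = (j \notin A).

Definition delta (k j : J) : int := (j == k)%:R.

Lemma sum_delta (x : J -> int) k : \sum_m x m * delta k m = x k.
Proof.
rewrite (bigD1 k) //= /delta eqxx mulr1 big1 ?addr0 // => m /negPf ->.
by rewrite mulr0.
Qed.

Lemma type_eqP A B D : is_type D -> is_type A -> is_type B ->
  {in D, A =i B} -> A = B.
Proof.
move=> DT AT BT eqAB; apply/setP => j.
have [/eqAB//|nDj] := boolP (j \in D).
have /eqAB : c j \in D by rewrite DT nDj.
by rewrite AT BT => /negb_inj.
Qed.

Lemma type_compl A : is_type A -> is_type (~: A).
Proof. by move=> AT j; rewrite !inE AT. Qed.

Lemma type_card A : involutive c -> is_type A -> #|J| = (2 * #|A|)%N.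
Proof.
move=> cK AT; rewrite -(cardsC A) mulSn mul1n; congr addn.
rewrite -(card_imset _ (inv_inj cK)); apply: eq_card => j.
by rewrite -{1}(cK j) (mem_imset _ _ (inv_inj cK)) inE AT negbK.
Qed.

Lemma exists_neq_type A B :
  is_type A -> is_type B -> A != B ->
  exists2 j, j \in A & j \notin B.
Proof.
move=> AT BT neq; apply/exists_inP; rewrite -negb_forall_in.
apply: contra neq => /forall_inP AB; apply/eqP.
by apply: (type_eqP AT) => // j Aj; rewrite Aj AB.
Qed.

Lemma exists_agree_type A B :
  is_type A -> is_type B -> A != ~: B ->
  exists2 j, j \in A & j \in B.
Proof.
move=> AT BT /exists_neq_type[]// => [|j Aj]; first exact: type_compl.
by rewrite inE negbK => Bj; exists j.
Qed.

Variables (I : finType) (V : I -> {set J}).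

Hypothesis cK : involutive c.
Hypothesis VT : forall i, is_type (V i).
Hypothesis VC : forall i, exists i', V i' = ~: V i.

(** The lattice spanned by the indicators of the [V i] is a direct summand of
    Z^J: the pairs in [s] consist of a member of the family and of an integral
    linear form on Z^J, and the sum is a projection onto the span. *)
Definition summand :=
  exists s : seq (I * (J -> int)), forall i j,
    (j \in V i)%:R =
      \sum_(p <- s) (\sum_m (m \in V i)%:R * p.2 m) * (j \in V p.1)%:R :> int.

(* Evaluates the linear forms of a candidate [s], all of which are signed sums
   of coordinates. *)
Ltac expand_sums :=
  rewrite !big_cons big_nil /=;
  repeat (rewrite (eq_bigr _ (fun m _ => mulrDr _ _ _)) big_split /=);
  repeat (rewrite (eq_bigr _ (fun m _ => mulrN _ _)) sumrN /=);
  rewrite ?sum_delta.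

Lemma summand_rank2 v v' k :
  k \in V v -> V v' = ~: V v -> (forall i, V i = V v \/ V i = ~: V v) -> summand.
Proof.
move=> kv v'E all2.
exists [:: (v, delta k); (v', delta (c k))] => i j; expand_sums.
rewrite v'E !inE !VT; case: (all2 i) => ->; rewrite ?inE kv;
  by case: (j \in V v); rewrite /= ?(mulr0, mulr1, addr0, add0r).
Qed.

(** On the coordinates [k], [l] and [c l], the vectors [v], its complement and
    [w] read (1,1,0), (0,0,1) and (0,1,0): this matrix is unimodular. The
    complement of [w] is [v + v' - w]. *)
Lemma summand_rank3 v v' w k l :
  k \in V v -> k \notin V w -> l \in V v -> l \in V w -> V v' = ~: V v ->
  (forall i, [\/ V i = V v, V i = ~: V v, V i = V w | V i = ~: V w]) -> summand.
Proof.
move=> kv /negPf kw lv lw v'E all4.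
exists [:: (v, delta k); (v', delta (c l));
           (w, fun m => delta l m - delta k m)] => i j; expand_sums.
rewrite v'E !inE !VT; case: (all4 i) => ->; rewrite ?inE ?kv ?lv ?kw ?lw;
  by case: (j \in V v); case: (j \in V w).
Qed.

(** Here the span is the whole lattice of the functions [x] on J such that
    [x j + x (c j)] does not depend on [j], and this lattice contains the
    indicators of all CM types. On [i0], [i1], [k], [c k] the vectors [v], [v'],
    [w] and [u] read (1,1,1,0), (0,0,0,1), (0,1,1,0) and (1,0,1,0); the linear
    forms below are the dual basis. *)
Lemma summand_rank4 v v' w u i0 i1 k :
  V v = [set i0; i1; k] -> V v' = ~: V v ->
  [/\ i0 \notin V w, i1 \in V w & k \in V w] ->
  [/\ i0 \in V u, i1 \notin V u & k \in V u] -> summand.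
Proof.
move=> vE v'E [/negPf w0 w1 wk] [u0 /negPf u1 uk].
exists [:: (v, fun m => delta i0 m + delta i1 m - delta k m);
           (v', delta (c k));
           (w, fun m => delta k m - delta i0 m);
           (u, fun m => delta k m - delta i1 m)] => i j; expand_sums.
have [v0 v1 vk]: [/\ i0 \in V v, i1 \in V v & k \in V v].
  by rewrite vE !inE !eqxx !orbT.
rewrite v'E inE !VT.
(* The values at [j] and [c j] add up to 1, on either side. *)
wlog jv : j / j \in V v.
  move=> IH; have [jv|jv] := boolP (j \in V v); first by have := IH j jv; rewrite jv.
  have := IH (c j); rewrite !VT (negPf jv) => /(_ isT).
  by case: (j \in V i); case: (i0 \in V i); case: (i1 \in V i);
     case: (k \in V i); case: (j \in V w); case: (j \in V u).
rewrite jv; move: jv; rewrite vE !inE => /orP[/orP[]|] /eqP ->;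
  rewrite ?w0 ?w1 ?wk ?u0 ?u1 ?uk;
  by case: (i0 \in V i); case: (i1 \in V i); case: (k \in V i).
Qed.

(** After replacing [u] by its complement if necessary, [u] contains [a]; then
    exactly one of [b] and [d] is in [u], as otherwise [u] is [v] or the
    complement of [w]. *)
Lemma exists_rank4 v v' w u a b d :
  V v = [set a; b; d] -> V v' = ~: V v ->
  [/\ a \notin V w, b \in V w & d \in V w] ->
  [/\ V u != V v, V u != ~: V v, V u != V w & V u != ~: V w] -> summand.
Proof.
move=> vE v'E wabd.
wlog au : u / a \in V u.
  move=> IH [uv uv' uw uw']; have [au|au] := boolP (a \in V u).
    exact: (IH u).
  have [u' u'E] := VC u; apply: (IH u'); rewrite u'E ?inE //.
  have eqC (A B : {set J}) : (~: A == B) = (A == ~: B).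
    by apply/eqP/eqP => [<-|->]; rewrite setCK.
  by split; rewrite eqC ?setCK.
case=> uv _ _ uw'; case: (wabd) => aw bw dw.
have eqv B : is_type B -> a \in B -> (b \in V u) = (b \in B) ->
    (d \in V u) = (d \in B) -> V u == B.
  move=> BT aB eb ed; apply/eqP; apply: (type_eqP (VT v)) => // j.
  by rewrite vE !inE => /orP[/orP[]|] /eqP ->; rewrite ?au.
have [bu|bu] := boolP (b \in V u); have [du|du] := boolP (d \in V u).
- by case/negP: uv; apply: eqv; rewrite ?bu ?du // vE !inE eqxx ?orbT.
- apply: (@summand_rank4 v v' w u a d b) => //.
  by rewrite vE -!setUA [[set b] :|: _]setUC.
- exact: (@summand_rank4 v v' w u a b d).
- case/negP: uw'; apply: eqv; rewrite ?inE ?bw ?dw ?(negPf bu) ?(negPf du) //.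
  exact: type_compl.
Qed.

(** This is where the bound on [g] enters: three elements of [v] are needed to
    tell apart three members that are neither equal nor complementary, hence
    they exhaust [v]. *)
Lemma types_summand : (#|J| <= 6)%N -> summand.
Proof.
move=> J6.
have [v _|I0] := pickP I; last by exists [::] => i; have := I0 i.
have [v' v'E] := VC v.
have [v0|[k kv]] := set_0Vmem (V v).
  exists [::] => i j; have: c j \in V v by rewrite VT v0 inE.
  by rewrite v0 inE.
have [w /andP[wv wv']|all2] := pickP [pred w | V w != V v & V w != ~: V v];
    last first.
  apply: (summand_rank2 kv v'E) => i; move/negbT: (all2 i).
  by rewrite negb_and !negbK => /orP[]/eqP; [left|right].
have [i0 i0v i0w] : exists2 j, j \in V v & j \notin V w.
  by apply: exists_neq_type => //; rewrite eq_sym.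
have [i1 i1v i1w] : exists2 j, j \in V v & j \in V w.
  apply: exists_agree_type => //.
  by apply: contra wv' => /eqP->; rewrite setCK.
have [u /and4P[uv uv' uw uw']|all4] := pickP [pred u | [&& V u != V v,
    V u != ~: V v, V u != V w & V u != ~: V w]]; last first.
  apply: (summand_rank3 i0v i0w i1v i1w v'E) => i; move/negbT: (all4 i).
  by rewrite !negb_and !negbK => /or4P[]/eqP; constructor.
have v3 : (#|V v| <= 3)%N by move: J6; rewrite (type_card cK (VT v)); lia.
(* If [i0] and [i1] exhaust [v], then only four CM types exist. *)
have [l]: exists2 l, l \in V v & l \notin [set i0; i1].
  apply/exists_inP; rewrite -negb_forall_in.
  apply/negP => /forall_inP sub.
  have eqv B : is_type B -> (i0 \in V u) = (i0 \in B) ->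
      (i1 \in V u) = (i1 \in B) -> V u == B.
    move=> BT e0 e1; apply/eqP; apply: (type_eqP (VT v)) => // j /sub.
    by rewrite !inE => /orP[]/eqP ->.
  move: (eqv _ (VT v)) (eqv _ (VT w)) (eqv _ (type_compl (VT v)))
        (eqv _ (type_compl (VT w))).
  rewrite !inE i0v i1v (negPf i0w) i1w.
  rewrite (negPf uv) (negPf uv') (negPf uw) (negPf uw').
  by case: (i0 \in V u); case: (i1 \in V u) => /=; auto.
rewrite !inE negb_or => lv /andP[li0 li1].
have vE : V v = [set i0; i1; l].
  apply/esym/eqP; rewrite eqEcard; apply/andP; split.
    by rewrite !subUset !sub1set i0v i1v lv.
  apply: leq_trans v3 _; rewrite -setUA cardsU1 cards2 !inE negb_or.
  have -> : i0 != i1 by apply: contraNneq i0w => ->.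
  by rewrite ![_ == l]eq_sym li0 li1.
have [lw|lw] := boolP (l \in V w); 
  first by exact: (exists_rank4 vE v'E (And3 i0w i1w lw) (And4 uv uv' uw uw')).
(* The complement of [w] omits one element of [v], this time [i1]. *)
have [w' w'E] := VC w.
apply: (@exists_rank4 v v' w' u i1 i0 l) => //.
- by rewrite vE [[set i0; i1]]setUC.
- by rewrite w'E !inE i1w i0w lw.
- by rewrite w'E setCK.
Qed.

End CMTypes.

(** * Complex conjugation on the embeddings of a CM field *)

Section Embeddings.

Variable L : splittingFieldType rat.
Implicit Types (M F : {subfield L}) (a b : gal_of {:L}).

Lemma emb_ofP M (C : emb M) : exists b, C = emb_of M b.
Proof. by have [b _ Cb] := rcosetsP (valP C); exists b; apply: val_inj. Qed.

Lemma emb_act1 M (C : emb M) : emb_act C 1%g = C.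
Proof. by apply: val_inj; rewrite /= rcoset1. Qed.

Lemma emb_actK M a : cancel (fun C : emb M => emb_act C a)
                            (fun C => emb_act C a^-1%g).
Proof. by move=> C; rewrite -emb_actM mulgV emb_act1. Qed.

Lemma emb_actKV M a : cancel (fun C : emb M => emb_act C a^-1%g)
                             (fun C => emb_act C a).
Proof. by move=> C; rewrite -emb_actM mulVg emb_act1. Qed.

Lemma galois_top M : galois 1%AS {:L} -> galois M {:L}.
Proof. by apply: galoisS; rewrite sub1v subvf. Qed.

Lemma index_gal M F : galois 1%AS {:L} -> (F <= M)%VS ->
  #|'Gal({:L} / F) : 'Gal({:L} / M)|%g = \dim_F M.
Proof.
move=> galL sFM; rewrite -divgS ?galS //.
have dM := galois_dim (galois_top M galL).
have dF := galois_dim (galois_top F galL).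
have M_gt0 : (0 < \dim_M {:L})%N by rewrite dM cardG_gt0.
rewrite -dM -dF; apply/eqP; rewrite -(eqn_pmul2r (adim_gt0 F)).
rewrite -(dim_sup_field sFM) -(eqn_pmul2l M_gt0) -dim_sup_field ?subvf //.
have dvdFM : (\dim_M {:L} %| \dim_F {:L})%N by rewrite dM dF cardSg ?galS.
by rewrite mulnA [(\dim_M _ * _)%N]mulnC divnK // -dim_sup_field ?subvf.
Qed.

Lemma card_emb M : galois 1%AS {:L} -> #|{: emb M}| = \dim M.
Proof.
move=> galL; have := index_gal galL (sub1v M).
rewrite dimv1 divn1 => <-; rewrite card_sig.
by apply: eq_card => C; rewrite !inE.
Qed.

End Embeddings.

Section CMConjugation.

Variables (L : splittingFieldType rat) (iota : {rmorphism L -> algC}).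
Variables (rho : gal_of {:L}) (E : {subfield L}).
Hypotheses (galL : galois 1%AS {:L}) (rhoP : complex_conj iota rho).

Lemma complex_conj_invol : (rho * rho)%g = 1%g.
Proof.
apply/eqP/gal_eqP => x _; rewrite galM ?memvf // gal_id.
by apply: (fmorph_inj iota); rewrite !rhoP conjCK.
Qed.

Lemma emb_conjK (C : emb E) : emb_act (emb_act C rho) rho = C.
Proof. by rewrite -emb_actM complex_conj_invol emb_act1. Qed.

Lemma real_gal_fix (a : gal_of {:L}) x :
  (iota (a x) \is Num.real) = ((a * rho * a^-1)%g x == x).
Proof.
have aE : a ((a * rho * a^-1)%g x) = rho (a x).
  by rewrite -galM ?memvf // mulgVK galM ?memvf.
by rewrite CrealE -rhoP (inj_eq (fmorph_inj iota)) -aE (inj_eq (fmorph_inj a)).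
Qed.

Hypothesis hCM : CM_field E.

(** The group Gal(L/E) has index 2 in Gal(L/F), and all conjugates of [rho] lie
    in Gal(L/F) because [F] is totally real, but not in Gal(L/E) because [E] is
    totally imaginary. So they all lie in one coset of Gal(L/E), that is, they
    agree on [E]. *)
Lemma emb_conj_central (a b : gal_of {:L}) :
  emb_of E (a * rho * b)%g = emb_of E (a * b * rho)%g.
Proof.
have [Eim [F [sFE dimEF Freal]]] := hCM.
have out d : (d * rho * d^-1)%g \in 'Gal({:L} / F) :\: 'Gal({:L} / E).
  rewrite !inE; apply/andP; split; last first.
    rewrite gal_kHom ?subvf //; apply/kAHomP => x xF.
    have := Freal (iota \o (d \o vsval)) (Subvs xF).
    by rewrite /= real_gal_fix => /eqP.
  have [x] := Eim (iota \o (d \o vsval)); rewrite /= real_gal_fix.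
  by apply: contra => /fixed_gal ->; rewrite ?subvf ?subvsP.
have cst d : 'Gal({:L} / E) :* (d * rho * d^-1) =
             'Gal({:L} / F) :\: 'Gal({:L} / E).
  by apply: rcoset_index2; rewrite ?galS // index_gal.
apply: val_inj => /=.
have -> : (a * rho * b = (a * rho * a^-1) * (a * b))%g by rewrite !mulgA mulgVK.
have -> : (a * b * rho = (a * b * rho * (a * b)^-1) * (a * b))%g.
  by rewrite mulgVK.
by rewrite [LHS]rcosetM [RHS]rcosetM !cst.
Qed.

Lemma emb_act_conjC (C : emb E) b :
  emb_act (emb_act C rho) b = emb_act (emb_act C b) rho.
Proof. by have [a ->] := emb_ofP C; rewrite !emb_of_act emb_conj_central. Qed.

End CMConjugation.

Lemma CM_type_is_type (L : splittingFieldType rat) (iota : {rmorphism L -> algC})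
    (rho : gal_of {:L}) (E : {subfield L}) (Sigma : {set emb E}) :
  complex_conj iota rho -> CM_type rho Sigma ->
  is_type (fun C : emb E => emb_act C rho) Sigma.
Proof.
move=> rhoP [covS disjS] C.
have imE : (C \in [set emb_act C rho | C in Sigma]) = (emb_act C rho \in Sigma).
  apply/imsetP/idP => [[D DS ->]|CS]; first by rewrite (emb_conjK rhoP).
  by exists (emb_act C rho) => //; rewrite (emb_conjK rhoP).
have := in_setT C; rewrite -covS inE imE.
have := in_set0 C; rewrite -disjS inE imE.
by case: (C \in Sigma); case: (_ \in Sigma).
Qed.

Lemma reciprocity_coef (L : splittingFieldType rat) (E : {subfield L})
    (Sigma : {set emb E}) b j :
  reciprocity (cochar_basis (emb_of (reflex_field Sigma) b)) j =
  (emb_act j b^-1%g \in Sigma)%:R.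
Proof.
rewrite reciprocityE sum_ffunE.
under eq_bigr => C _ do rewrite ffunE -(can_eq (emb_actKV b)) emb_actK.
have [jS|jS] := boolP (_ \in Sigma).
  rewrite (bigD1 _ jS) /= eqxx big1 ?addr0 // => C /andP[_ /negPf].
  by rewrite eq_sym => ->.
by rewrite big1 // => C CS; case: eqP => // eqC; rewrite eqC CS in jS.
Qed.

(** * Connectedness of the kernel of the reciprocity morphism *)

Theorem proposition4p7
    (L : splittingFieldType rat) (iota : {rmorphism L -> algC})
    (rho : gal_of {:L}%VS) (E : {subfield L}) (g : nat) (Sigma : {set emb E})
    (hL : galois_closure E)
    (hrho : complex_conj iota rho)
    (hCM : CM_field E)
    (hdeg : \dim E = (2 * g)%N)
    (hSigma : CM_type rho Sigma)
    (hg : (g <= 3)%N) :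
  zariski_connected (torus_ker (@reciprocity L E Sigma)).
Proof.
have [galL _] := hL.
pose E' := reflex_field Sigma.
pose c (C : emb E) := emb_act C rho.
have [V VR] : exists V : emb E' -> {set emb E}, forall B j,
    reciprocity (cochar_basis B) j = (j \in V B)%:R.
  exists (fun B => [set j | reciprocity (cochar_basis B) j == 1]) => B j.
  have [b ->] := emb_ofP B.
  by rewrite inE reciprocity_coef; case: (_ \in Sigma).
have VE b j : (j \in V (emb_of E' b)) = (emb_act j b^-1%g \in Sigma).
  have := VR (emb_of E' b) j; rewrite reciprocity_coef.
  by case: (_ \in Sigma); case: (_ \in V _).
have SigmaT : is_type c Sigma := CM_type_is_type hrho hSigma.
have [s hs] : summand V.
  apply: (@types_summand _ c).
  - exact: emb_conjK.
  - move=> B j; have [b ->] := emb_ofP B.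
    by rewrite !VE (emb_act_conjC galL hrho hCM) SigmaT.
  - move=> B; have [b ->] := emb_ofP B; exists (emb_of E' (b * rho)%g).
    apply/setP => j; rewrite in_setC !VE invMg emb_actM.
    have -> : rho^-1%g = rho.
      by apply/eqP; rewrite eq_invg_mul (complex_conj_invol hrho).
    by rewrite (emb_act_conjC galL hrho hCM) SigmaT.
  - by rewrite card_emb // hdeg; lia.
apply: (@torus_ker_connected_basis _ _ _ s) => B j.
apply: etrans (VR B j) _.
rewrite hs; apply: eq_bigr => p _; congr (_ * _); last exact: (esym (VR _ _)).
by apply: eq_bigr => m _; congr (_ * _); apply: (esym (VR _ _)).
Qed.
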